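(* Let $Z(\beta,N)$ be the canonical partition function, at inverse temperature $\beta$, of an interacting quantum gas of $N$ identical particles (bosons or fermions) of mass $m$ with pairwise interactions in a volume $V$. Then $$Z(\beta,N)=\frac{1}{N!}B_N(\Gamma_1,\Gamma_2,\Gamma_3,\dots,\Gamma_N),$$ where $B_N(x_1,\dots,x_N)$ is the (complete) Bell polynomial and $$\Gamma_l=\frac{l!\,V}{\lambda^3}\,b_l ,$$ with $b_l$ the expansion coefficients of the quantum cluster expansion and $\lambda=h\sqrt{\beta/(2\pi m)}$ the thermal wavelength.
   Context: The $i$-particle Hamiltonian is $H_i=-\frac{\hbar^2}{2m}\sum_{l=1}^{i}\nabla_l^2+\sum_{j<l}U_{jl}$, where $U_{jl}$ is the interaction potential between particles $j$ and $l$, and $h=2\pi\hbar$ is Planck's constant. The canonical partition function is $Z(\beta,N)=\sum_s e^{-\beta E_s}$, where $E_s$ are the eigenvalues of the $N$-particle system and $s$ labels its states. The quantum cluster expansion coefficients are $$b_l=\frac{1}{l!\,V\,\lambda^{3(l-1)}}\int d^{3l}q\,\langle q_1,\dots,q_l|U_l|q_1,\dots,q_l\rangle ,$$ where the state vectors $|q_1,q_2,\dots\rangle$ are symmetric for bosons and antisymmetric for fermions (which encodes the quantum exchange interaction), and the cluster functions $U_l$ are $$\langle q_1'|U_1|q_1\rangle=\lambda^3\langle q_1'|e^{-\beta H_1}|q_1\rangle,$$ $$\langle q_1',q_2'|U_2|q_1,q_2\rangle=\lambda^6\left[\langle q_1',q_2'|e^{-\beta H_2}|q_1,q_2\rangle-\langle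 q_1'|e^{-\beta H_1}|q_1\rangle\langle q_2'|e^{-\beta H_1}|q_2\rangle\right],$$ and so on. That is, as in the standard (textbook) quantum cluster expansion, the $U_l$ are successively determined by $$\lambda^{3n}\langle q'_1,\dots,q'_n|e^{-\beta H_n}|q_1,\dots,q_n\rangle=\sum_{\pi}\prod_{B\in\pi}\langle q'_B|U_{|B|}|q_B\rangle\qquad(n\ge1),$$ with $\pi$ running over all set partitions of $\{1,\dots,n\}$ and $q_B=(q_i)_{i\in B}$; the states are normalized in the usual way so that $Z(\beta,N)=\frac{1}{N!}\int d^{3N}q\,\langle q_1,\dots,q_N|e^{-\beta H_N}|q_1,\dots,q_N\rangle$. Bell polynomial: $$B_N(x_1,\dots,x_N)=N!\sum_{\{m_l\}}\ \prod_{l=1}^N\left(\frac{x_l}{l!}\right)^{m_l}\frac{1}{m_l!},$$ the sum running over all sequences of nonnegative integers $(m_1,\dots,m_N)$ with $\sum_{l=1}^N l\,m_l=N$. *)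

(* Defs.v *)
From HB Require Import structures.
From mathcomp Require Import all_boot all_order all_algebra fingroup perm.
From mathcomp Require Import all_classical all_reals all_analysis.
From mathcomp.real_closed Require Import complex.

Set Implicit Arguments.
Unset Strict Implicit.
Unset Printing Implicit Defensive.

Import Order.TTheory GRing.Theory Num.Theory.
Import numFieldNormedType.Exports.

Local Open Scope classical_set_scope.
Local Open Scope complex_scope.
Local Open Scope ring_scope.

Definition tuple_cons (T : Type) n (p : T * n.-tuple T) : n.+1.-tuple T :=
  [tuple of p.1 :: p.2].

Lemma measurable_tuple_cons d (T : measurableType d) n :
  measurable_fun [set: T * n.-tuple T] (@tuple_cons T n).
Proof. exact: (measurable_cons measurable_fst measurable_snd). Qed.

Lemma measurable_tuple_uncons d (T : measurableType d) n :
  measurable_fun [set: n.+1.-tuple T]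
    (fun t : n.+1.-tuple T => (thead t, [tuple of behead t])).
Proof.
apply/measurable_fun_pairP; split.
  exact: measurable_tnth.
exact: measurable_behead.
Qed.

Definition cons_measure d (T : measurableType d) (R : realType) n
    (mu : set T -> \bar R) (nu : set (n.-tuple T) -> \bar R) :
    set (n.+1.-tuple T) -> \bar R :=
  pushforward (mu \x nu)%E (@tuple_cons T n).

Section cons_measure.
Context d (T : measurableType d) (R : realType) (n : nat)
  (mu : {sigma_finite_measure set T -> \bar R})
  (nu : {sigma_finite_measure set (n.-tuple T) -> \bar R}).

Let mcons := @measurable_tuple_cons d T n.

Let cons_measure0 : cons_measure mu nu set0 = 0%E.
Proof. by rewrite /cons_measure /pushforward preimage_set0 measure0. Qed.

Let cons_measure_ge0 A : (0 <= cons_measure mu nu A)%E.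
Proof. exact: measure_ge0. Qed.

Let cons_measure_sigma_additive : semi_sigma_additive (cons_measure mu nu).
Proof.
move=> F mF tF mUF; rewrite /cons_measure /pushforward preimage_bigcup.
apply: measure_semi_sigma_additive.
- by move=> k; rewrite -[X in measurable X]setTI; exact: mcons.
- apply/trivIsetP => /= i j _ _ ij; rewrite -preimage_setI.
  by move/trivIsetP : tF => /(_ _ _ _ _ ij) ->//; rewrite preimage_set0.
- by rewrite -preimage_bigcup -[X in measurable X]setTI; exact: mcons.
Qed.

HB.instance Definition _ := isMeasure.Build _ _ _ (cons_measure mu nu)
  cons_measure0 cons_measure_ge0 cons_measure_sigma_additive.

Let cons_sigma_finite : sigma_finite setT (cons_measure mu nu).
Proof.
have /sigma_finiteP[F [FT Fnd Foo]] := sigma_finiteT mu.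
have /sigma_finiteP[G [GT Gnd Goo]] := sigma_finiteT nu.
pose uncons (t : n.+1.-tuple T) : T * n.-tuple T :=
  (thead t, [tuple of behead t]).
exists (fun k => uncons @^-1` (F k `*` G k)).
  apply/esym; rewrite -subTset => t _.
  have [k1 _ Fk1] : (\bigcup_k F k) (thead t) by rewrite -FT.
  have [k2 _ Gk2] : (\bigcup_k G k) [tuple of behead t] by rewrite -GT.
  exists (maxn k1 k2) => //=; split => /=.
    by move: Fk1; exact/subsetPset/Fnd/leq_maxl.
  by move: Gk2; exact/subsetPset/Gnd/leq_maxr.
move=> k; have [mF Fk] := Foo k; have [mG Gk] := Goo k; split.
  rewrite -[X in measurable X]setTI; apply: measurable_tuple_uncons => //.
  exact: measurableX.
rewrite /cons_measure /pushforward (_ : _ @^-1` _ = F k `*` G k).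
  by rewrite product_measure1E// lte_mul_pinfty// ge0_fin_numE.
have unconsK p : uncons (tuple_cons p) = p.
  case: p => x t; rewrite /uncons theadE; congr pair.
  exact: val_inj.
by rewrite -comp_preimage (_ : _ \o _ = id)//; apply/funext.
Qed.

HB.instance Definition _ :=
  Measure_isSigmaFinite.Build _ _ _ (cons_measure mu nu) cons_sigma_finite.

End cons_measure.

Fixpoint power_measure d (T : measurableType d) (R : realType)
    (mu : {sigma_finite_measure set T -> \bar R}) n :
    {sigma_finite_measure set (n.-tuple T) -> \bar R} :=
  match n return {sigma_finite_measure set (n.-tuple T) -> \bar R} with
  | 0 => dirac [tuple]
  | k.+1 => cons_measure mu (power_measure mu k)
  end.

Definition position (R : realType) := (3.-tuple (measurableTypeR R))%type.

Definition config (R : realType) n := (n.-tuple (position R))%type.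

Definition space_measure (R : realType) :
    {sigma_finite_measure set (position R) -> \bar R} :=
  power_measure (@lebesgue_measure R) 3.

Definition config_measure (R : realType) n :
    {sigma_finite_measure set (config R n) -> \bar R} :=
  power_measure (space_measure R) n.

(* The library differentiates on matrices and integrates on tuples; [coords]
   goes from the second presentation of R^(3n) to the first. *)
Definition coords (R : realType) n (q : config R n) : 'M[R]_(n, 3) :=
  \matrix_(l, k) tnth (tnth q l) k.

Definition box (R : realType) (Omega : set (position R)) n : set (config R n) :=
  [set q | forall l : 'I_n, Omega (tnth q l)].
Arguments box {R} Omega n.

Definition Cintegral (R : realType) n (D : set (config R n))
    (f : config R n -> R[i]) : R[i] :=
  Complex (\int[config_measure R n]_(q in D) complex.Re (f q))
          (\int[config_measure R n]_(q in D) complex.Im (f q)).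

(* An eigenfunction expansion sum_s w_s psi_s(q') psi_s(q)^* with summable
   weights converges for almost all q', q; elsewhere [limn] returns an
   unspecified value, which no integral sees. *)
Definition Cseries (R : realType) (u : nat -> R[i]) : R[i] :=
  Complex (limn (series (fun s => complex.Re (u s))))
          (limn (series (fun s => complex.Im (u s)))).

Variant statistics := Boson | Fermion.

(* Openness is stated on row vectors, where the library has the topology of R^3;
   measurability follows from it and is recorded for convenience. *)
Record quantum_gas (R : realType) := QuantumGas {
  stat : statistics;
  planck : R;
  mass : R;
  container : set (position R);
  pair_potential : position R -> position R -> R;
  planck_gt0 : 0 < planck;
  mass_gt0 : 0 < mass;
  container_open :
    open [set x : 'rV[R]_3 | container [tuple x ord0 k | k < 3]];
  container_measurable : measurable container;
  container_volume_gt0 : (0 < space_measure R container)%E;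
  container_volume_lty : (space_measure R container < +oo)%E;
  pair_potential_sym : forall x y, pair_potential x y = pair_potential y x;
  pair_potential_measurable :
    measurable_fun setT (fun p : position R * position R =>
      pair_potential p.1 p.2)
}.

Section quantum_gas_definitions.
Context (R : realType) (G : quantum_gas R).

Definition volume : R := fine (space_measure R (container G)).

Definition hbar : R := planck G / (2 * pi).

Definition thermal_wavelength (beta : R) : R :=
  planck G * Num.sqrt (beta / (2 * pi * mass G)).

Definition partial n (l : 'I_n) (k : 'I_3) (phi : 'M[R]_(n, 3) -> R) :
    'M[R]_(n, 3) -> R :=
  fun x => 'D_(delta_mx l k) phi x.

Definition hamiltonian n (phi : 'M[R]_(n, 3) -> R) (q : config R n) : R :=
  - (hbar ^+ 2 / (2 * mass G)) *
    (\sum_(l < n) \sum_(k < 3) partial l k (partial l k phi) (coords q))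
  + (\sum_(l < n) \sum_(j < n | (j < l)%N)
       pair_potential G (tnth q j) (tnth q l)) * phi (coords q).

Fixpoint Ck (k : nat) n (phi : 'M[R]_(n, 3) -> R) : Prop :=
  continuous phi /\
  match k with
  | 0 => True
  | k'.+1 => forall (l : 'I_n) (j : 'I_3),
      (forall x, derivable phi x (delta_mx l j)) /\ Ck k' (partial l j phi)
  end.

Definition test_function n (phi : 'M[R]_(n, 3) -> R) : Prop :=
  (forall k, Ck k phi) /\
  exists K : set 'M[R]_(n, 3),
    [/\ compact K, K `<=` @coords R n @` box (container G) n &
        forall x, ~ K x -> phi x = 0].

(* [H psi = e psi] in the container in the sense of distributions (H is real
   and formally symmetric, so it is moved onto the test function). Classical
   eigenfunctions are covered, and so are those which are not C^2 where the
   potential is singular. *)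
Definition energy_eigenfunction n (psi : config R n -> R[i]) (e : R) : Prop :=
  forall phi, test_function phi ->
    [/\ (config_measure R n).-integrable (box (container G) n)
          (fun q => (complex.Re (psi q) * hamiltonian phi q)%:E),
        (config_measure R n).-integrable (box (container G) n)
          (fun q => (complex.Im (psi q) * hamiltonian phi q)%:E) &
        Cintegral (box (container G) n)
          (fun q => psi q * (hamiltonian phi q)%:C) =
        e%:C * Cintegral (box (container G) n)
          (fun q => psi q * (phi (coords q))%:C)].

Definition square_integrable n (f : config R n -> R[i]) : Prop :=
  [/\ measurable_fun (box (container G) n) (fun q => complex.Re (f q)),
      measurable_fun (box (container G) n) (fun q => complex.Im (f q)) &
      (\int[config_measure R n]_(q in box (container G) n)
         (complex.Re (f q) ^+ 2 + complex.Im (f q) ^+ 2)%:E < +oo)%E].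

Definition inner n (f g : config R n -> R[i]) : R[i] :=
  Cintegral (box (container G) n) (fun q => conjc (f q) * g q).

Definition exchange_sign n (sigma : 'S_n) : R[i] :=
  match stat G with
  | Boson => 1
  | Fermion => (-1) ^+ (sigma : bool)
  end.

Definition permute n (sigma : 'S_n) (q : config R n) : config R n :=
  [tuple tnth q (sigma l) | l < n].

Definition exchange_symmetric n (f : config R n -> R[i]) : Prop :=
  forall sigma q, box (container G) n q ->
    f (permute sigma q) = exchange_sign sigma * f q.

(* Data diagonalizing a self-adjoint realization of the n-particle Hamiltonian
   on the Hilbert space of (anti)symmetric square-integrable functions. The
   boundary conditions (Dirichlet, periodic, ...) are left arbitrary: they are
   determined by the eigenbasis. States are labelled by nat, which for n > 0
   is no restriction as that space is then separable and infinite-dimensional;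
   eigenvalues are repeated according to their multiplicity. *)
Record energy_eigenbasis n (psi : nat -> config R n -> R[i]) (E : nat -> R) :
    Prop := EnergyEigenbasis {
  eigenbasis_symmetric : forall s, exchange_symmetric (psi s);
  eigenbasis_L2 : forall s, square_integrable (psi s);
  eigenbasis_orthonormal : forall s t, inner (psi s) (psi t) = (s == t)%:R;
  eigenbasis_complete : forall f : config R n -> R[i],
    exchange_symmetric f -> square_integrable f ->
    (forall s, inner (psi s) f = 0) ->
    {ae config_measure R n, forall q, box (container G) n q -> f q = 0};
  eigenbasis_energy : forall s, energy_eigenfunction (psi s) (E s)
}.

(* <q|psi>, where |q_1,...,q_n> = (n!)^(-1/2) sum_sigma (+-1)^sigma
   |q_sigma(1)>...|q_sigma(n)> is the (anti)symmetric position state. On the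
   (anti)symmetric subspace these states resolve the identity as
   (1/n!) \int d^{3n}q |q><q| = 1, whence Tr A = (1/n!) \int d^{3n}q <q|A|q>. *)
Definition amplitude n (q : config R n) (psi : config R n -> R[i]) : R[i] :=
  ((Num.sqrt (n`!%:R))^-1)%:C *
    \sum_(sigma : 'S_n) exchange_sign sigma * psi (permute sigma q).

(* <q'| e^{-beta H_n} |q> = sum_s e^{-beta E_s} <q'|s><s|q> *)
Definition boltzmann_kernel (beta : R) n (psi : nat -> config R n -> R[i])
    (E : nat -> R) (q' q : config R n) : R[i] :=
  Cseries (fun s => (expR (- beta * E s))%:C *
    (amplitude q' (psi s) * conjc (amplitude q (psi s)))).

End quantum_gas_definitions.

Definition partition_function (R : realType) (beta : R) (E : nat -> R) : R :=
  limn (series (fun s => expR (- beta * E s))).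

Definition subconfig (R : realType) n (q : config R n) (B : {set 'I_n}) :
    config R #|B| :=
  [tuple tnth q (enum_val i) | i < #|B|].

(* The equation for n expresses U n, the term of the one-block partition,
   through the kernel K n and the U k with k < n; so it determines U. *)
Definition cluster_functions (R : realType) (lambda : R)
    (K U : forall n, config R n -> config R n -> R[i]) : Prop :=
  forall n (q' q : config R n), (0 < n)%N ->
    (lambda ^+ (3 * n))%:C * K n q' q =
    \sum_(P : {set {set 'I_n}} | finset.partition P [set: 'I_n]%SET)
      \prod_(B in P) U #|B| (subconfig q' B) (subconfig q B).

Definition cluster_coefficient (R : realType) (G : quantum_gas R) (beta : R)
    (U : forall n, config R n -> config R n -> R[i]) (l : nat) : R[i] :=
  ((l`!%:R * volume G * thermal_wavelength G beta ^+ (3 * l.-1))^-1)%:C *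
    Cintegral (box (container G) l) (fun q => U l q q).

(* The entries x 1, ..., x N are used. The multiplicity of l = i + 1 is m i; it
   is at most N whenever \sum_l l m_l = N. *)
Definition bell (F : fieldType) (N : nat) (x : nat -> F) : F :=
  N`!%:R *
  \sum_(m : {ffun 'I_N -> 'I_N.+1} | (\sum_(i < N) i.+1 * m i == N)%N)
    \prod_(i < N) ((x i.+1 / (i.+1)`!%:R) ^+ m i / (m i)`!%:R).

(* Main.v *)
(* On the diagonal of the box the (anti)symmetrized kernel is
   N! sum_s e^{-beta E_s} |psi_s|^2, so by monotone convergence its integral is
   N! Z(beta, N). Integrate the defining relation of the cluster functions over
   the box: every product over the blocks of a set partition factorizes, which
   gives lambda^{3N} N! Z as the sum over the partitions P of {1,...,N} of
   prod_{B in P} I_|B|, where I_l is the integral of the diagonal of U_l. The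
   integrability needed comes from the same relation, by induction on n, since
   it expresses U_n through the kernel and the U_k with k < n.
   It remains to see that sum_P prod_{B in P} x_|B| = B_N(x_1,...,x_N): both
   sides satisfy N a_N = sum_l l C(N,l) x_l a_{N-l}. *)
Require Import Defs.
From HB Require Import structures.
From mathcomp Require Import all_boot all_order all_algebra fingroup perm.
From mathcomp Require Import all_classical all_reals all_analysis.
From mathcomp Require Import measurable_realfun zify ring.
From mathcomp.real_closed Require Import complex.

Set Implicit Arguments.
Unset Strict Implicit.
Unset Printing Implicit Defensive.

Import Order.TTheory GRing.Theory Num.Theory.
Import numFieldNormedType.Exports.

Local Open Scope classical_set_scope.
Local Open Scope complex_scope.
Local Open Scope ring_scope.

(** * Sums over set partitions and the complete Bell polynomial *)

Definition partition_sum (F : numFieldType) (T : finType) (x : nat -> F)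
    (D : {set T}) : F :=
  \sum_(P : {set {set T}} | finset.partition P D) \prod_(B in P) x #|B|.

(* The bounds L and M are independent of n so that the terms of the recursion
   in n share one index type. *)
Definition bell_sum (F : numFieldType) (L M : nat) (y : nat -> F) (n : nat) :
    F :=
  \sum_(m : {ffun 'I_L -> 'I_M.+1} | (\sum_(i < L) i.+1 * m i == n)%N)
    \prod_(i < L) (y i.+1 ^+ m i / (m i)`!%:R).

(** Since [#|D|] is the sum of the block sizes of [P], the left side counts pairs of a partition and
    one of its blocks [B], weighted by [#|B|]. Deleting [B] leaves an arbitrary partition of
    [D :\: B]. *)
Lemma partition_sum_rec (F : numFieldType) (T : finType) (x : nat -> F)
    (D : {set T}) :
  #|D|%:R * partition_sum x D =
  \sum_(B : {set T} | B \subset D)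
    #|B|%:R * x #|B| * partition_sum x (D :\: B).
Proof.
transitivity (\sum_(B : {set T} | B \subset D)
    \sum_(P : {set {set T}} | finset.partition P D && (B \in P))
      #|B|%:R * \prod_(A in P) x #|A|).
  rewrite /partition_sum mulr_sumr.
  under eq_bigr => P pP.
    rewrite (card_partition pP) natr_sum mulr_suml.
    over.
  rewrite (exchange_big_dep (fun B : {set T} => B \subset D))//= => P B.
  exact: partitionS.
apply: eq_bigr => B BD.
(* An empty [B] contributes 0 on both sides through the factor [#|B|]. *)
have [->|[b bB]] := finset.set_0Vmem B.
  by rewrite cards0 !mul0r big1// => P _; rewrite mul0r.
rewrite /partition_sum mulr_sumr.
have B0 : B != finset.set0 by apply/finset.set0Pn; exists b.
have BN P : finset.partition P (D :\: B) -> B \notin P.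
  move=> pP; apply/negP => /(partitionS pP)/fintype.subsetP/(_ _ bB).
  by rewrite finset.inE bB.
(* The side condition [(B |: P) :\ B == P] produced here says that [B] is not in [P]. *)
rewrite (reindex_onto (fun P => B |: P) (fun P => P :\ B)); last first.
  by move=> P /andP[_ BP]; rewrite finset.setD1K.
apply: eq_big => P.
  rewrite finset.setU11 andbT; apply/andP/idP => [[pP /eqP PE]|pP].
    by rewrite -PE; apply: partitionD1 => //; rewrite finset.setU11.
  have DE : D = B :|: (D :\: B).
    by rewrite -[LHS](finset.setID D B) (finset.setIidPr BD).
  split; last by rewrite finset.setU1K ?BN.
  rewrite DE; apply: partitionU1 => //.
  rewrite -setI_eq0; apply/eqP/setP => t.
  by rewrite !finset.inE; case: (t \in B).
move=> /andP[/andP[pP _] /eqP PE].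
have BP : B \notin P by rewrite -PE !finset.inE eqxx.
by rewrite big_setU1//= mulrA.
Qed.

Lemma sum_subset_card (R : nzRingType) (T : finType) (D : {set T})
    (g : nat -> R) :
  \sum_(B : {set T} | B \subset D) g #|B| =
  \sum_(k < #|D|.+1) g k *+ 'C(#|D|, k).
Proof.
rewrite (partition_big (fun B : {set T} => inord #|B| : 'I_#|D|.+1) xpredT)//=.
apply: eq_bigr => k _; rewrite -cards_draws -sumr_const.
have BE (B : {set T}) : B \subset D -> (inord #|B| == k) = (#|B| == k).
  by move=> BD; rewrite -val_eqE /= inordK// ltnS subset_leq_card.
apply: eq_big => [B|B /andP[BD]].
  by rewrite finset.inE; case BD: (B \subset D); rewrite //= BE.
by rewrite BE// => /eqP->.
Qed.

Lemma bell_sum0 (F : numFieldType) (L M : nat) (y : nat -> F) :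
  bell_sum L M y 0 = 1.
Proof.
rewrite /bell_sum (big_pred1 [ffun=> ord0]) => [|m].
  by rewrite big1// => i _; rewrite ffunE expr0 fact0 divr1.
apply/idP/eqP => [|->]; last by rewrite big1// => i _; rewrite ffunE muln0.
rewrite sum_nat_eq0 => /fintype.forallP/= m0; apply/ffunP => i; rewrite ffunE.
by apply/val_inj/eqP; rewrite /= -(eqn_pmul2l (ltn0Sn i)) muln0 m0.
Qed.

(** With A(z) = exp(sum_l y_l z^l), this compares coefficients in z A'(z) = (sum_l l y_l z^l) A(z).
    Combinatorially, n is written as sum_l l m_l, and the factor m_l turns y_l^{m_l} / m_l! into y_l
    times the same term with m_l lowered by one. *)
Lemma bell_sum_rec (F : numFieldType) (L M : nat) (y : nat -> F) (n : nat) :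
  (n <= L)%N -> (n <= M)%N ->
  n%:R * bell_sum L M y n =
  \sum_(i < n) i.+1%:R * y i.+1 * bell_sum L M y (n - i.+1).
Proof.
move=> nL nM; rewrite /bell_sum mulr_sumr.
transitivity (\sum_(i < L) i.+1%:R *
    \sum_(m : {ffun 'I_L -> 'I_M.+1} | (\sum_(i < L) i.+1 * m i == n)%N)
      (m i)%:R * \prod_(i < L) (y i.+1 ^+ m i / (m i)`!%:R)).
  under [RHS]eq_bigr => i _ do rewrite mulr_sumr.
  rewrite exchange_big/=; apply: eq_bigr => m /eqP mn.
  rewrite -[in LHS]mn natr_sum mulr_suml; apply: eq_bigr => i _.
  by rewrite natrM mulrA.
pose g (i : nat) : F := i.+1%:R * y i.+1 * bell_sum L M y (n - i.+1).
transitivity (\sum_(i < L | (i < n)%N) g i); last first.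
  by rewrite -(big_ord_widen _ g nL).
rewrite [RHS]big_mkcond; apply: eq_bigr => i _.
have le_m (m : {ffun 'I_L -> 'I_M.+1}) (j : 'I_L) :
    (j.+1 * m j <= \sum_(i < L) i.+1 * m i)%N.
  by rewrite (bigD1 j)//= leq_addr.
(* If [n < i.+1], the bound [i.+1 * m i <= n] forces [m i = 0]. *)
case: ltnP => ni; last first.
  rewrite big1 ?mulr0// => m /eqP mn; have := le_m m i; rewrite mn.
  case: (nat_of_ord (m i)) => [|k]; first by rewrite mul0r.
  by rewrite mulnS => /(leq_trans (leq_addr _ _)); rewrite leqNgt ltnS ni.
rewrite /g -mulrA; congr (_ * _); rewrite /bell_sum mulr_sumr.
(* Terms with [m i = 0] vanish through the factor [m i]; the others are reindexed by raising the
   [i]-th multiplicity of a smaller term. *)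
rewrite (bigID (fun m : {ffun 'I_L -> 'I_M.+1} => m i == ord0))/=.
rewrite big1 ?add0r; last first.
  by move=> m /andP[_ /eqP->]; rewrite mul0r.
(* [inord] sends values out of range to 0, so [up] is an increment only when [m i < M]; [lt_m]
   derives this from [n <= M]. *)
pose up (m : {ffun 'I_L -> 'I_M.+1}) : {ffun 'I_L -> 'I_M.+1} :=
  [ffun j => if j == i then inord (m j).+1 else m j].
pose down (m : {ffun 'I_L -> 'I_M.+1}) : {ffun 'I_L -> 'I_M.+1} :=
  [ffun j => if j == i then inord (m j).-1 else m j].
rewrite (reindex_onto up down); last first.
  move=> m /andP[_ mi]; apply/ffunP => j; rewrite !ffunE; case: eqP => // ->.
  have {}mi : (0 < m i)%N by rewrite lt0n; exact: mi.
  rewrite inordK ?(leq_ltn_trans (leq_pred _) (ltn_ord _))// prednK//.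
  by rewrite inord_val.
have up_sum (m : {ffun 'I_L -> 'I_M.+1}) : (m i < M)%N ->
    (\sum_(j < L) j.+1 * up m j = i.+1 + \sum_(j < L) j.+1 * m j)%N.
  move=> mM; rewrite (bigD1 i)//= [in RHS](bigD1 i)//= ffunE eqxx inordK//.
  rewrite mulnS addnA; congr addn.
  by apply: eq_bigr => j /negbTE ji; rewrite ffunE ji.
have lt_m (m : {ffun 'I_L -> 'I_M.+1}) :
    (\sum_(j < L) j.+1 * m j = n - i.+1)%N -> (m i < M)%N.
  move=> mn; have := le_m m i; rewrite mn mulSn => /(leq_trans (leq_addr _ _)).
  by move=> /leq_ltn_trans; apply; lia.
have key (m : {ffun 'I_L -> 'I_M.+1}) :
    ((\sum_(j < L) j.+1 * up m j == n)%N && (up m i != ord0) &&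
      (down (up m) == m)) =
    (\sum_(j < L) j.+1 * m j == n - i.+1)%N.
  apply/idP/eqP.
    case: (ltnP (m i) M) => [mM|Mm].
      move=> /andP[/andP[/eqP + _] _]; rewrite up_sum// => <-.
      by rewrite addKn.
    (* At the maximal multiplicity the increment overflows to 0, which the condition
       [up m i != ord0] excludes. *)
    have {Mm} -> : (up m i != ord0) = false; last by rewrite andbF.
    rewrite ffunE eqxx; apply/negbTE; rewrite negbK /inord /insubd insubF//.
    by apply/negbTE; rewrite -leqNgt !ltnS.
  move=> mn; have mM := lt_m m mn.
  rewrite up_sum// mn subnKC// eqxx/= ffunE eqxx -val_eqE/= inordK//=.
  apply/eqP/ffunP => j; rewrite !ffunE; case: eqP => // ->.
  by apply/val_inj; rewrite /= !inordK//= ltnS ltnW.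
apply: eq_big => m; first exact: key.
rewrite key => /eqP mn.
have mM := lt_m m mn.
rewrite (bigD1 i)//= [in RHS](bigD1 i)//= ffunE eqxx inordK//.
rewrite !mulrA; congr (_ * _); last first.
  by apply: eq_bigr => j /negbTE ji; rewrite ffunE ji.
rewrite exprS factS natrM invfM; field.
by rewrite nat1r !pnatr_eq0 -lt0n fact_gt0.
Qed.

(** Strong induction on [#|D|]: after multiplication by [#|D|] the two recursions agree, because
    grouping subsets by their size b yields binomials with C(n,b) b! (n-b)! = n!. *)
Lemma partition_sumE (F : numFieldType) (T : finType) (x : nat -> F)
    (D : {set T}) (L M : nat) : (#|D| <= L)%N -> (#|D| <= M)%N ->
  partition_sum x D =
  (#|D|)`!%:R * bell_sum L M (fun l => x l / l`!%:R) #|D|.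
Proof.
have [n] := ubnP #|D|; elim: n => // n IH in D *; rewrite ltnS => Dn DL DM.
have [D0|D0] := posnP #|D|.
  rewrite D0 bell_sum0 fact0 mulr1; move/eqP: D0; rewrite cards_eq0 => /eqP->.
  rewrite /partition_sum (big_pred1 finset.set0) => [|P].
    by rewrite finset.big_set0.
  by rewrite finset.partition_set0.
apply: (mulfI (x := #|D|%:R)); first by rewrite pnatr_eq0 -lt0n.
rewrite partition_sum_rec mulrCA bell_sum_rec//.
pose y l := x l / l`!%:R.
transitivity (\sum_(B : {set T} | B \subset D) #|B|%:R * x #|B| *
   ((#|D| - #|B|)`!%:R * bell_sum L M y (#|D| - #|B|))).
  apply: eq_bigr => B BD.
  have DBE : #|D :\: B| = (#|D| - #|B|)%N
    by rewrite cardsD (finset.setIidPr BD).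
  (* For empty [B] the set [D :\: B] is no smaller than [D], but the coefficient is 0. *)
  have [->|B0] := finset.set_0Vmem B; first by rewrite cards0 !mul0r.
  have {}B0 : (0 < #|B|)%N by case: B0 => b bB; apply/card_gt0P; exists b.
  by congr (_ * _); rewrite IH ?DBE//; lia.
rewrite (sum_subset_card D (fun b => b%:R * x b *
   ((#|D| - b)`!%:R * bell_sum L M y (#|D| - b)))).
rewrite big_ord_recl !mul0r mul0rn add0r mulr_sumr.
apply: eq_bigr => i _; rewrite lift0 /y.
rewrite -mulr_natr -(@bin_fact #|D| i.+1) ?ltn_ord//.
rewrite (natrM _ 'C(_, _)) (natrM _ (i.+1)`!).
have : (i.+1)`!%:R != 0 :> F by rewrite pnatr_eq0 -lt0n fact_gt0.
by move: ((i.+1)`!%:R) => q q0; field.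
Qed.

(** * Factorization of integrals of nonnegative products over a power of a measure space *)

(* Blocks are selected as lists rather than tuples, which avoids casts between
   tuple types of propositionally equal sizes. *)
Definition select n (J : finType) (c : 'I_n -> J) (j : J) (T : Type)
    (t : n.-tuple T) : seq T :=
  [seq tnth t i | i <- enum 'I_n & c i == j].

Lemma size_select n (J : finType) (c : 'I_n -> J) j T (t : n.-tuple T) :
  size (select c j t) = #|[pred i | c i == j]|.
Proof. by rewrite size_map cardE enumT. Qed.

Lemma select_cons n (J : finType) (c : 'I_n.+1 -> J) j T x (t : n.-tuple T) :
  select c j (tuple_cons (x, t)) =
  (if c ord0 == j then cons x else id) (select (c \o lift ord0) j t).
Proof.
rewrite /select enum_ordSl /=.
have E s : [seq ((tnth (tuple_cons (x, t))) \o lift ord0) i | i <- s] =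
    [seq tnth t i | i <- s].
  by apply: eq_map => i /=; rewrite tnthS.
by case: ifP => _ /=; rewrite filter_map -map_comp E.
Qed.

Section tonelli.
Context d (T : measurableType d) (R : realType).
Variable mu : {sigma_finite_measure set T -> \bar R}.

(** A function on lists stands for a family of functions, one on each power of [T]. *)
Definition seq_measurable (f : seq T -> \bar R) :=
  forall n, measurable_fun [set: n.-tuple T] (fun t : n.-tuple T => f t).

Lemma seq_measurable_cons (f : seq T -> \bar R) x :
  seq_measurable f -> seq_measurable (fun s => f (x :: s)).
Proof.
move=> mf n; apply: (@measurableT_comp _ _ _ _ _ _ _ _
  (fun t : n.-tuple T => [the n.+1.-tuple T of x :: t]) (mf n.+1)).
exact: measurable_cons.
Qed.

Lemma seq_measurable_select (f : seq T -> \bar R)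
    n (J : finType) (c : 'I_n -> J) j :
  seq_measurable f ->
  measurable_fun [set: n.-tuple T] (fun t => f (select c j t)).
Proof.
move=> mf; pose s := [seq i <- enum 'I_n | c i == j].
apply: (@measurableT_comp _ _ _ _ _ _ _ _
  (fun t : n.-tuple T => [tuple of map (tnth t) (in_tuple s)]) (mf (size s))).
apply/measurable_fun_tnthP => i.
rewrite (_ : _ \o _ = fun t => tnth t (tnth (in_tuple s) i)).
  exact: measurable_tnth.
by apply/funext => t /=; rewrite tnth_map.
Qed.

Definition power_integral n (f : seq T -> \bar R) : \bar R :=
  (\int[power_measure mu n]_t f (tval t))%E.

Local Open Scope ereal_scope.

Lemma power_integral0 f : seq_measurable f -> power_integral 0 f = f [::].
Proof.
move=> mf; rewrite /power_integral /= integral_dirac ?diracT ?mul1e//.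
exact: mf.
Qed.

Lemma power_integralS n f : seq_measurable f -> (forall s, 0 <= f s) ->
  power_integral n.+1 f = \int[mu]_x power_integral n (fun s => f (x :: s)).
Proof.
move=> mf f0; rewrite /power_integral /= /cons_measure.
rewrite (@ge0_integral_pushforward _ _ _ _ _ _
  (@measurable_tuple_cons _ T n))//=; last exact: mf.
rewrite fubini_tonelli1//.
exact: (measurableT_comp (mf n.+1) (@measurable_tuple_cons _ T n)).
Qed.

Lemma measurable_power_integral n f :
  seq_measurable f -> (forall s, 0 <= f s) ->
  measurable_fun setT (fun x => power_integral n (fun s => f (x :: s))).
Proof.
move=> mf f0; rewrite /power_integral.
apply: (@measurable_fun_fubini_tonelli_F _ _ _ _ _ (power_measure mu n)
  (fun p : T * n.-tuple T => f (p.1 :: p.2))) => //=.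
exact: (measurableT_comp (mf n.+1) (@measurable_tuple_cons _ T n)).
Qed.

Lemma emeasurable_prod d' (X : measurableType d') (J : finType)
    (f : J -> X -> \bar R) :
  (forall j, measurable_fun setT (f j)) ->
  measurable_fun setT (fun t => \prod_j f j t).
Proof.
move=> mf; elim: (index_enum J) => [|j s IH].
  by under eq_fun do rewrite big_nil; exact: measurable_cst.
by under eq_fun do rewrite big_cons; exact: emeasurable_funM.
Qed.

Lemma prode_ge0 (J : finType) (P : pred J) (f : J -> \bar R) :
  (forall j, 0 <= f j) -> 0 <= \prod_(j | P j) f j.
Proof. by move=> f0; elim/big_ind: _ => // *; exact: mule_ge0. Qed.

Lemma power_integral_ge0 n f : (forall s, 0 <= f s) -> 0 <= power_integral n f.
Proof. by move=> f0; exact: integral_ge0. Qed.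

(** The map [c] colours the coordinates, and the factor [f j] sees only those of colour [j].
    Induction on [n] integrates out the first coordinate by Tonelli; it occurs only in the factor of
    colour [c ord0]. *)
Lemma power_integral_prod n (J : finType) (c : 'I_n -> J)
    (f : J -> seq T -> \bar R) :
  (forall j, seq_measurable (f j)) -> (forall j s, 0 <= f j s) ->
  \int[power_measure mu n]_t \prod_j f j (select c j t) =
  \prod_j power_integral #|[pred i | c i == j]| (f j).
Proof.
move=> mf f0.
have mF k (c' : 'I_k -> J) (g : J -> seq T -> \bar R) :
    (forall j, seq_measurable (g j)) ->
    measurable_fun setT (fun t : k.-tuple T => \prod_j g j (select c' j t)).
  by move=> mg; apply: emeasurable_prod => j; exact: seq_measurable_select.
elim: n => [|n IH] in c f mf f0 *.
  rewrite integral_dirac ?diracT ?mul1e//; last exact: mF.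
  apply: eq_bigr => j _.
  rewrite (_ : #|_| = 0%N) ?power_integral0//.
    by rewrite (size0nil (s := select _ _ _))// size_select eq_card0// => -[].
  by rewrite eq_card0// => -[].
rewrite /= /cons_measure.
rewrite (@ge0_integral_pushforward _ _ _ _ _ _
  (@measurable_tuple_cons _ T n))//=; last 2 first.
- exact: mF.
- by move=> t _; exact: prode_ge0.
rewrite fubini_tonelli1//=; last 2 first.
- exact: (measurableT_comp (mF _ _ _ mf) (@measurable_tuple_cons _ T n)).
- by move=> t; exact: prode_ge0.
rewrite /fubini_F.
set j0 := c ord0; pose c' := c \o lift ord0.
pose g x j := if j0 == j then fun s => f j (x :: s) else f j.
have cardS j : #|[pred i | c i == j]| = ((j0 == j) + #|[pred i | c' i == j]|)%N.
  rewrite -!sum1_card [LHS]big_mkcond [in RHS]big_mkcond big_ord_recl.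
  rewrite !inE -/j0 /=.
  by congr (_ + _)%N; case: (j0 == j).
have E x :
    \int[power_measure mu n]_t \prod_j f j (select c j (tuple_cons (x, t))) =
    (\prod_(j | j != j0) power_integral #|[pred i | c i == j]| (f j)) *
      power_integral #|[pred i | c' i == j0]| (fun s => f j0 (x :: s)).
  transitivity (\int[power_measure mu n]_t \prod_j g x j (select c' j t)).
    apply: eq_integral => t _; apply: eq_bigr => j _.
    by rewrite select_cons /g -/j0; case: ifP.
  rewrite IH; last 2 first.
  - by move=> j; rewrite /g; case: ifP => // _; exact: seq_measurable_cons.
  - by move=> j s; rewrite /g; case: ifP.
  rewrite (bigD1 j0)//= muleC; congr (_ * _); last by rewrite /g eqxx.
  by apply: eq_bigr => j jj0; rewrite /g cardS eq_sym (negbTE jj0).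
under eq_integral do rewrite E.
(* The product over the other colours does not depend on [x]; it is a nonnegative, possibly infinite
   constant. *)
rewrite ge0_integralZl//; last 3 first.
- exact: measurable_power_integral.
- by move=> x _; exact: power_integral_ge0.
- by apply: prode_ge0 => j; exact: power_integral_ge0.
rewrite -power_integralS// [RHS](bigD1 j0)//= muleC.
by congr (power_integral _ _ * _); rewrite cardS eqxx.
Qed.
End tonelli.

(** * Factorization for integrable real factors of either sign *)

Section signed.
Context d (T : measurableType d) (R : realType).
Variable mu : {sigma_finite_measure set T -> \bar R}.

Definition power_integrable n (f : seq T -> R) :=
  (power_measure mu n).-integrable [set: n.-tuple T] (fun t => (f t)%:E).

Definition power_Rintegral n (f : seq T -> R) : R :=
  \int[power_measure mu n]_t f (tval t).

Lemma power_RintegralE n f : power_integrable n f ->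
  (\int[power_measure mu n]_t (f (tval t))%:E)%E = (power_Rintegral n f)%:E.
Proof.
move=> If; rewrite /power_Rintegral/Rintegral fineK//.
exact: integrable_fin_num.
Qed.

(** Integrability of [f] is known at one length only; cutting off to 0 at other lengths gives a
    function that is measurable on every power. *)
Definition at_size n (f : seq T -> R) (s : seq T) : R :=
  if size s == n then f s else 0.

Lemma at_size_tuple n (f : seq T -> R) (t : n.-tuple T) : at_size n f t = f t.
Proof. by rewrite /at_size size_tuple eqxx. Qed.

Lemma seq_measurable_at_size n f : power_integrable n f ->
  seq_measurable (fun s => (at_size n f s)%:E).
Proof.
move=> If m; have [->|nm] := eqVneq m n.
  apply: eq_measurable_fun (measurable_int _ If) => t _.
  by rewrite at_size_tuple.
rewrite (_ : (fun _ => _) = cst 0%E); first exact: measurable_cst.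
by apply/funext => t; rewrite /at_size size_tuple (negbTE nm).
Qed.

Lemma prodEFin (J : finType) (f : J -> R) :
  (\prod_j (f j)%:E = (\prod_j f j)%:E)%E.
Proof. by elim/big_rec2: _ => // j y1 y2 _ ->; rewrite EFinM. Qed.

Lemma power_integrable_prod_ge0 n (J : finType) (c : 'I_n -> J)
    (f : J -> seq T -> R) (m := fun j => #|[pred i | c i == j]|) :
  (forall j, power_integrable (m j) (f j)) -> (forall j s, 0 <= f j s) ->
  (power_measure mu n).-integrable [set: n.-tuple T]
    (fun t => (\prod_j f j (select c j t))%:E) /\
  \int[power_measure mu n]_t (\prod_j f j (select c j t)) =
  \prod_j power_Rintegral (m j) (f j).
Proof.
move=> If f0.
have E (t : n.-tuple T) : (\prod_j f j (select c j t))%:E =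
   (\prod_j ((at_size (m j) (f j)) (select c j t))%:E)%E.
  rewrite prodEFin; congr _%:E; apply: eq_bigr => j _.
  by rewrite /at_size size_select eqxx.
have m_at j := seq_measurable_at_size (If j).
have at_ge0 j s : (0 <= (at_size (m j) (f j) s)%:E)%E.
  by rewrite lee_fin /at_size; case: ifP.
have IE : (\int[power_measure mu n]_t (\prod_j f j (select c j t))%:E =
    (\prod_j power_Rintegral (m j) (f j))%:E)%E.
  under eq_integral do rewrite E.
  rewrite (power_integral_prod mu _
    (f := fun j s => (at_size (m j) (f j) s)%:E))//.
  rewrite -prodEFin; apply: eq_bigr => j _; rewrite -power_RintegralE//.
  by apply: eq_integral => t _; rewrite at_size_tuple.
split; last by rewrite /Rintegral IE.
apply/integrableP; split.
  rewrite (funext E).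
  by apply: emeasurable_prod => j; exact: (seq_measurable_select _ _ (m_at j)).
(* The product is its own absolute value, and its integral has just been found finite. *)
under eq_integral do rewrite abse_EFin ger0_norm ?prodr_ge0//.
by rewrite IE ltry.
Qed.

Lemma Rintegral_sum d' (X : measurableType d') (nu : {measure set X -> \bar R})
    (I : finType) (P : pred I) (f : I -> X -> R) :
  (forall i, P i -> nu.-integrable setT (fun x => (f i x)%:E)) ->
  \int[nu]_x (\sum_(i | P i) f i x) = \sum_(i | P i) \int[nu]_x f i x.
Proof.
move=> If; pose g i x := if P i then f i x else 0.
have Ig i : nu.-integrable setT (fun x => (g i x)%:E).
  rewrite /g; have [Pi|_] := boolP (P i); first exact: If.
  exact: integrable0.
transitivity (\int[nu]_x (\sum_(i | P i) g i x)).
  by apply: eq_Rintegral => x _; apply: eq_bigr => i Pi; rewrite /g Pi.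
transitivity (\sum_(i | P i) \int[nu]_x g i x); last first.
  by apply: eq_bigr => i Pi; apply: eq_Rintegral => x _; rewrite /g Pi.
rewrite /Rintegral; under eq_integral do rewrite -sumEFin.
rewrite integral_sum//.
under eq_bigr => i _ do rewrite -(fineK (integrable_fin_num _ (Ig i)))//.
by rewrite sumEFin.
Qed.

(** Each factor is split into positive and negative parts and the product is expanded over all
    choices [e] of parts. Every term is covered by the nonnegative case, and distributivity
    reassembles the integrals. *)
Lemma power_integrable_prod n (J : finType) (c : 'I_n -> J)
    (f : J -> seq T -> R) (m := fun j => #|[pred i | c i == j]|) :
  (forall j, power_integrable (m j) (f j)) ->
  (power_measure mu n).-integrable [set: n.-tuple T]
    (fun t => (\prod_j f j (select c j t))%:E) /\
  \int[power_measure mu n]_t (\prod_j f j (select c j t)) =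
  \prod_j power_Rintegral (m j) (f j).
Proof.
move=> If.
pose h (b : bool) j := if b then (f j)^\- else (f j)^\+.
have Ih b j : power_integrable (m j) (h b j).
  case: b.
    apply: (integrable_funrneg (f := fun t : (m j).-tuple T => f j t)) => //.
    exact: If.
  apply: (integrable_funrpos (f := fun t : (m j).-tuple T => f j t)) => //.
  exact: If.
have h0 b j s : 0 <= h b j s.
  by case: b; [exact: funrneg_ge0|exact: funrpos_ge0].
have fE j s : f j s = \sum_(b : bool) (-1) ^+ b * h b j s.
  rewrite big_bool /= expr1 expr0 mul1r mulN1r.
  by rewrite -[in LHS](funrposBneg (f j)) addrC.
pose g (e : {ffun J -> bool}) (t : n.-tuple T) : R :=
  \prod_j ((-1) ^+ e j * h (e j) j (select c j t)).
have gE t : \prod_j f j (select c j t) = \sum_e g e t.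
  by under eq_bigr do rewrite fE; rewrite bigA_distr_bigA.
have ge (e : {ffun J -> bool}) :
    (power_measure mu n).-integrable setT (fun t => (g e t)%:E) /\
    \int[power_measure mu n]_t g e t =
    \prod_j ((-1) ^+ e j * power_Rintegral (m j) (h (e j) j)).
  have [I1 E1] := power_integrable_prod_ge0
    (fun j => Ih (e j) j) (fun j => h0 (e j) j).
  have gE' t : g e t = (\prod_j (-1) ^+ e j) * \prod_j h (e j) j (select c j t).
    by rewrite -big_split.
  split.
    by under eq_fun do rewrite gE' EFinM; exact: integrableZl.
  by under eq_Rintegral do rewrite gE'; rewrite RintegralZl// E1 -big_split.
split.
  under eq_fun do rewrite gE -sumEFin.
  by apply: integrable_sum => // e _; have [] := ge e.
under eq_Rintegral do rewrite gE.
rewrite Rintegral_sum; last by move=> e _; have [] := ge e.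
under [LHS]eq_bigr => e _ do rewrite (ge e).2.
rewrite -(bigA_distr_bigA (fun j b =>
  (-1) ^+ (b : bool) * power_Rintegral (m j) (h b j))).
apply: eq_bigr => j _.
rewrite big_bool /= expr1 expr0 mul1r mulN1r addrC -RintegralB//; last 2 first.
- exact: (Ih false).
- exact: (Ih true).
by apply: eq_Rintegral => t _; rewrite -[in RHS](funrposBneg (f j)).
Qed.
End signed.

(** * Integrating series of nonnegative functions *)

Lemma limn_series_fine (R : realType) (u : nat -> R) : (forall s, 0 <= u s) ->
  limn (series u) = fine (\sum_(s <oo) (u s)%:E)%E.
Proof.
move=> u0.
have uE : (fun n => \sum_(0 <= s < n) (u s)%:E)%E = EFin \o series u.
  by apply/funext => n; rewrite /series/= sumEFin.
rewrite uE; have [cu|nu] := pselect (cvgn (series u)).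
  by rewrite EFin_lim.
(* For a divergent series the default value of [limn] is 0, which is also [fine +oo]. *)
suff -> : limn (EFin \o series u) = +oo%E by rewrite (dvgP nu).
apply: cvg_lim => //; apply/cvgeryP; apply: nondecreasing_dvgn_lt => //.
by apply: nondecreasing_series => s _ _; exact: u0.
Qed.

(** By monotone convergence the extended-real sum [g] integrates term by term to the finite total
    weight. Hence [g] is finite almost everywhere, and there it agrees with [q]. *)
Lemma mixture_integrable d (X : measurableType d) (R : realType)
    (mu : {measure set X -> \bar R}) (D : set X) (w : nat -> R)
    (p : nat -> X -> R) :
  measurable D -> (forall s, 0 <= w s) -> (forall s x, 0 <= p s x) ->
  (forall s, measurable_fun D (p s)) ->
  (forall s, (\int[mu]_(x in D) (p s x)%:E)%E = 1%E) ->
  cvgn (series w) ->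
  let q x := limn (series (fun s => w s * p s x)) in
  mu.-integrable D (fun x => (q x)%:E) /\
  \int[mu]_(x in D) q x = limn (series w).
Proof.
move=> mD w0 p0 mp p1 cw q.
pose g x := (\sum_(s <oo) (w s * p s x)%:E)%E.
have wp0 s x : 0 <= w s * p s x by exact: mulr_ge0.
have qE x : q x = fine (g x) by apply: limn_series_fine.
have mwp s : measurable_fun D (fun x => (w s * p s x)%:E).
  by apply/measurable_EFinP; exact: measurable_funM.
have g0 x : (0 <= g x)%E by apply: nneseries_ge0 => s _ _; rewrite lee_fin.
have mg : measurable_fun D g.
  by apply: ge0_emeasurable_sum => *; rewrite ?lee_fin.
have gI : (\int[mu]_(x in D) g x = (limn (series w))%:E)%E.
  rewrite integral_nneseries//; last by move=> s x _; rewrite lee_fin.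
  rewrite -EFin_lim//; congr (limn _); apply/funext => n.
  rewrite /series/= -sumEFin; apply: eq_bigr => s _.
  under eq_integral do rewrite EFinM.
  rewrite ge0_integralZl ?p1 ?mule1 ?lee_fin//; first exact/measurable_EFinP.
  by move=> x _; rewrite lee_fin.
have Ig : mu.-integrable D g.
  apply/integrableP; split => //.
  by under eq_integral do rewrite gee0_abs//; rewrite gI ltry.
have mq : measurable_fun D (fun x => (q x)%:E).
  apply/measurable_EFinP; rewrite (_ : q = fine \o g); last exact/funext.
  by apply: measurableT_comp mg; exact: fine_measurable.
have qg : ae_eq mu D (fun x => (q x)%:E) g.
  apply: filterS (integrable_ae mD Ig) => x /= + Dx => /(_ Dx) gx.
  by rewrite qE fineK.
have Iq : (\int[mu]_(x in D) (q x)%:E = (limn (series w))%:E)%E.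
  by rewrite (ae_eq_integral g).
split; last by rewrite /Rintegral Iq.
apply/integrableP; split => //.
under eq_integral do rewrite abse_EFin ger0_norm ?qE ?fine_ge0// -qE.
by rewrite Iq ltry.
Qed.

(** * The diagonal of the Boltzmann kernel and its trace *)

Section kernel.
Context (R : realType) (G : quantum_gas R).

(** The sign squares to 1, so all n! summands equal [f q], and n! / sqrt(n!) = sqrt(n!). *)
Lemma amplitude_symmetric n (q : config R n) (f : config R n -> R[i]) :
  exchange_symmetric G f -> box (container G) n q ->
  amplitude G q f = (Num.sqrt n`!%:R)%:C * f q.
Proof.
move=> sf bq; rewrite /amplitude.
have E (sigma : 'S_n) : exchange_sign G sigma * f (permute sigma q) = f q.
  rewrite sf// mulrA /exchange_sign; case: (stat G); first by rewrite !mul1r.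
  by rewrite -expr2 sqrr_sign mul1r.
under eq_bigr do rewrite E.
rewrite sumr_const card_Sn -[f q *+ _]mulr_natl mulrA; congr (_ * _).
rewrite -(rmorph_nat (real_complex R)) -rmorphM; congr (_%:C).
have n0 : 0 <= n`!%:R :> R by [].
rewrite -[in X in _ * X](sqr_sqrtr n0) expr2 mulrA mulVf ?mul1r//.
Qed.

Lemma boltzmann_kernel_diag (beta : R) n (psi : nat -> config R n -> R[i])
    (E : nat -> R) (q : config R n) :
  (forall s, exchange_symmetric G (psi s)) -> box (container G) n q ->
  boltzmann_kernel G beta psi E q q =
  (limn (series (fun s => n`!%:R * expR (- beta * E s) *
     (complex.Re (psi s q) ^+ 2 + complex.Im (psi s q) ^+ 2))))%:C.
Proof.
move=> sp bq; rewrite /boltzmann_kernel.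
pose a s := n`!%:R * expR (- beta * E s) *
  (complex.Re (psi s q) ^+ 2 + complex.Im (psi s q) ^+ 2).
have aE s : (expR (- beta * E s))%:C *
    (amplitude G q (psi s) * conjc (amplitude G q (psi s))) = (a s)%:C.
  rewrite amplitude_symmetric// /a; case: (psi s q) => x y /=.
  simpc; congr Complex; last by ring.
  rewrite -[in RHS](sqr_sqrtr (ler0n R n`!)); ring.
rewrite /Cseries.
have -> : (fun s => complex.Re ((expR (- beta * E s))%:C *
    (amplitude G q (psi s) * conjc (amplitude G q (psi s))))) = a.
  by apply/funext => s; rewrite aE.
have -> : (fun s => complex.Im ((expR (- beta * E s))%:C *
    (amplitude G q (psi s) * conjc (amplitude G q (psi s))))) = cst 0.
  by apply/funext => s; rewrite aE.
congr Complex; apply: cvg_lim => //.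
rewrite (_ : series _ = cst 0); first exact: cvg_cst.
by apply/funext => k; rewrite /series/= big1.
Qed.

(** An instance of [mixture_integrable] with weights n! e^{-beta E_s} and probability densities
    |psi_s|^2. *)
Lemma boltzmann_kernel_integral (beta : R) n (psi : nat -> config R n -> R[i])
    (E : nat -> R) : (forall s, square_integrable G (psi s)) ->
  (forall s, inner G (psi s) (psi s) = 1) ->
  cvgn (series (fun s => expR (- beta * E s))) ->
  measurable (box (container G) n) ->
  let k q := limn (series (fun s => n`!%:R * expR (- beta * E s) *
     (complex.Re (psi s q) ^+ 2 + complex.Im (psi s q) ^+ 2))) in
  (config_measure R n).-integrable (box (container G) n) (fun q => (k q)%:E) /\
  \int[config_measure R n]_(q in box (container G) n) k q =
    n`!%:R * partition_function beta E.
Proof.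
move=> psi2 psi1 cE mB k.
have p0 s q : 0 <= complex.Re (psi s q) ^+ 2 + complex.Im (psi s q) ^+ 2.
  by rewrite addr_ge0// sqr_ge0.
have seriesE : series (fun s => n`!%:R * expR (- beta * E s)) =
    n`!%:R \*o series (fun s => expR (- beta * E s)).
  by apply/funext => m; rewrite /series/= mulr_sumr.
have cw : cvgn (series (fun s => n`!%:R * expR (- beta * E s))).
  by rewrite seriesE; exact: is_cvgMr.
have [] := @mixture_integrable _ _ _ (config_measure R n) (box (container G) n)
  (fun s => n`!%:R * expR (- beta * E s))
  (fun s q => complex.Re (psi s q) ^+ 2 + complex.Im (psi s q) ^+ 2)
  mB _ p0 _ _ cw.
- by move=> s; rewrite mulr_ge0 ?expR_ge0.
- move=> s; have [m1 m2 _] := psi2 s.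
  by apply: measurable_funD; exact: measurable_funX.
- move=> s; have [m1 m2 p2] := psi2 s.
  have := psi1 s; rewrite /inner /Cintegral => -[] /= + _.
  rewrite /Rintegral.
  under eq_integral => q _.
    rewrite (_ : complex.Re _ =
        complex.Re (psi s q) ^+ 2 + complex.Im (psi s q) ^+ 2); last first.
      by case: (psi s q) => x y /=; ring.
    over.
  (* Square integrability makes the integral finite, which lifts the real normalization to the
     extended reals. *)
  move=> I1; rewrite -[RHS]/(1%:E) -I1 fineK// ge0_fin_numE//.
  by apply: integral_ge0 => q _; rewrite lee_fin.
- move=> Ik ->; split => //; rewrite seriesE /partition_function.
  by apply: cvg_lim => //; apply: cvgMr; exact: cE.
Qed.

End kernel.

(** * Factorization along a set partition *)

Lemma pblock_eq n (P : {set {set 'I_n}}) (B : {set 'I_n}) :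
  finset.partition P [set: 'I_n]%SET -> B \in P ->
  forall i, (finset.pblock P i == B) = (i \in B).
Proof.
move=> pP BP i; have tP := finset.partition_trivIset pP.
apply/eqP/idP => [<-|iB]; last exact: finset.def_pblock.
by rewrite finset.mem_pblock (finset.cover_partition pP) finset.inE.
Qed.

(** Here [pblock P] is the colouring, with all subsets of ['I_n] as colours. A subset outside [P]
    colours no coordinate and gets the constant factor 1, whose integral over the one-point power is
    1. *)
Lemma partition_integrable d (T : measurableType d) (R : realType)
    (mu : {sigma_finite_measure set T -> \bar R}) n (P : {set {set 'I_n}})
    (v : seq T -> R) :
  finset.partition P [set: 'I_n]%SET ->
  (forall B, B \in P -> power_integrable mu #|B| v) ->
  (power_measure mu n).-integrable [set: n.-tuple T]
    (fun t => (\prod_(B in P) v [seq tnth t i | i <- enum B])%:E) /\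
  \int[power_measure mu n]_t (\prod_(B in P) v [seq tnth t i | i <- enum B]) =
  \prod_(B in P) power_Rintegral mu #|B| v.
Proof.
move=> pP Iv.
pose f (B : {set 'I_n}) := if B \in P then v else fun=> 1.
have cP B : B \in P -> #|[pred i | finset.pblock P i == B]| = #|B|.
  by move=> BP; apply: eq_card => i; exact: pblock_eq.
have cN B : B \notin P -> #|[pred i | finset.pblock P i == B]| = 0%N.
  move=> /negP BP; apply: eq_card0 => i; apply/negP => /eqP iB; apply: BP.
  by rewrite -iB finset.pblock_mem// (finset.cover_partition pP) finset.inE.
have If B : power_integrable mu #|[pred i | finset.pblock P i == B]| (f B).
  rewrite /f; case: ifPn => BP.
    by rewrite cP//; exact: Iv.
  rewrite cN//; apply/integrableP; split => //.
  by rewrite /= integral_dirac ?diracT ?mul1e ?normr1 ?ltry.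
have [] := power_integrable_prod If.
have fE (t : n.-tuple T) : \prod_B f B (select (finset.pblock P) B t) =
    \prod_(B in P) v [seq tnth t i | i <- enum B].
  rewrite [RHS]big_mkcond; apply: eq_bigr => B _; rewrite /f.
  case: ifP => // BP; rewrite /select enumT; congr (v (map _ _)).
  by apply: eq_filter; exact: pblock_eq.
under eq_fun do rewrite fE.
under eq_Rintegral do rewrite fE.
move=> ? ->; split => //.
rewrite [RHS]big_mkcond; apply: eq_bigr => B _; rewrite /f.
case: ifPn => BP; first by rewrite cP.
rewrite cN// /power_Rintegral /Rintegral/= integral_dirac ?diracT ?mul1e//.
Qed.

(** * Cluster functions on the diagonal of the box *)

Section cluster.
Context (R : realType) (G : quantum_gas R).

Lemma measurable_box n : measurable (box (container G) n).
Proof.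
rewrite (_ : box _ _ = \bigcap_(l in [set: 'I_n])
    ((fun q : config R n => tnth q l) @^-1` container G)).
  apply: fin_bigcap_measurable => // l _; rewrite -[X in measurable X]setTI.
  by apply: measurable_tnth => //; exact: container_measurable.
by apply/seteqP; split => q /= bq l; [move=> _|]; exact: bq.
Qed.

Lemma mem_box n (q : config R n) :
  box (container G) n q <-> all [in container G] q.
Proof.
split=> [bq|/all_tnthP bq l]; last by have := bq l; rewrite inE.
by apply/all_tnthP => l; rewrite inE.
Qed.

Lemma val_subconfig n (q : config R n) B :
  tval (subconfig q B) = [seq tnth q i | i <- enum B].
Proof.
apply: (@eq_from_nth _ point) => [|i]; rewrite size_tuple.
  by rewrite size_map -cardE.
move=> iB; rewrite -[i in LHS]/(val (Ordinal iB)) -tnth_nth tnth_mktuple.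
have x := enum_val (Ordinal iB).
by rewrite (enum_val_nth x) (nth_map x)// -cardE.
Qed.

Lemma map_tnth_setT n T (t : n.-tuple T) :
  [seq tnth t i | i <- enum [set: 'I_n]%SET] = t.
Proof. by rewrite finset.enum_setT -enumT map_tnth_enum. Qed.

(** As a function on lists, it treats blocks of all sizes at once. *)
Definition diagonal (U : forall n, config R n -> config R n -> R[i])
  (s : seq (position R)) : R[i] := U (size s) (in_tuple s) (in_tuple s).

Lemma diagonal_tuple U n (q : config R n) : diagonal U q = U n q q.
Proof.
case: q => s sn; have ns := eqP sn; subst n.
by rewrite (_ : Tuple sn = in_tuple s)//; exact: val_inj.
Qed.

(** Extension by 0 replaces integrals over the box by integrals over the whole space. Taking the
    real part loses nothing where [diagonal_real] applies. *)
Definition box_diagonal U (s : seq (position R)) : R :=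
  if all [in container G] s then complex.Re (diagonal U s) else 0.

(** A block with n elements is everything, and disjointness then leaves no other block. This makes
    the inductions on the number of particles well-founded. *)
Lemma block_lt n (P : {set {set 'I_n}}) B :
  finset.partition P [set: 'I_n]%SET -> P != [set [set: 'I_n]%SET]%SET ->
  B \in P ->
  (0 < #|B| < n)%N.
Proof.
move=> pP PT BP; rewrite card_gt0 (partition_neq0 pP BP)/= ltnNge.
apply: contra PT => nB.
have BT : B = [set: 'I_n]%SET.
  by apply/eqP; rewrite eqEcard finset.subsetT cardsT card_ord.
have tP := finset.partition_trivIset pP.
apply/eqP/setP => C; rewrite finset.inE.
apply/idP/eqP => [CP|->]; last by rewrite -BT.
have /finset.set0Pn[i iC] := partition_neq0 pP CP.
rewrite -(finset.def_pblock tP CP iC) (finset.def_pblock tP BP)//.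
by rewrite BT finset.inE.
Qed.

Lemma partition_setT n : (0 < n)%N ->
  finset.partition [set [set: 'I_n]%SET]%SET [set: 'I_n]%SET.
Proof.
case: n => // n _; apply/and3P; split.
- by rewrite /finset.cover finset.big_set1.
- apply/finset.trivIsetP => A B; rewrite !finset.inE => /eqP-> /eqP->.
  by rewrite eqxx.
- rewrite finset.inE eq_sym; apply/finset.set0Pn; exists ord0.
  by rewrite finset.inE.
Qed.

Lemma sum_partition_setT (V : nmodType) n (h : {set {set 'I_n}} -> V) :
  (0 < n)%N ->
  \sum_(P | finset.partition P [set: 'I_n]%SET) h P =
  h [set [set: 'I_n]%SET]%SET +
  \sum_(P | finset.partition P [set: 'I_n]%SET &&
            (P != [set [set: 'I_n]%SET]%SET)) h P.
Proof.
move=> n0; rewrite (bigD1 [set [set: 'I_n]%SET]%SET)//.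
exact: partition_setT.
Qed.

Lemma all_block n (q : config R n) (B : {set 'I_n}) :
  box (container G) n q -> all [in container G] [seq tnth q i | i <- enum B].
Proof. by move=> bq; apply/allP => _ /mapP[i _ ->]; rewrite inE. Qed.

Section expansion.
Variables (lambda : R) (K U : forall n, config R n -> config R n -> R[i]).
Variables (k : forall n, config R n -> R) (N : nat).
Hypothesis HU : cluster_functions lambda K U.
Hypothesis HK : forall n q, (0 < n <= N)%N -> box (container G) n q ->
  K q q = (k q)%:C.
Hypothesis Ik : forall n, (0 < n <= N)%N ->
  (config_measure R n).-integrable (box (container G) n) (fun q => (k q)%:E).

Let u := box_diagonal U.

Lemma diagonal_expansion n (q : config R n) : (0 < n <= N)%N ->
  box (container G) n q ->
  (lambda ^+ (3 * n) * k q)%:C =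
  \sum_(P | finset.partition P [set: 'I_n]%SET)
    \prod_(B in P) diagonal U [seq tnth q i | i <- enum B].
Proof.
move=> nN bq; have /andP[n0 _] := nN.
rewrite rmorphM/= -HK// HU//; apply: eq_bigr => P _; apply: eq_bigr => B _.
by rewrite -val_subconfig diagonal_tuple.
Qed.

(** Solving the cluster relation for its one-block term expresses U_n through the kernel, real on
    the diagonal, and products of U_k with k < n, real by induction. *)
Lemma diagonal_real n (q : config R n) : (0 < n <= N)%N ->
  box (container G) n q -> diagonal U q = (u q)%:C.
Proof.
have [m] := ubnP n; elim: m => // m IH in n q *; rewrite ltnS => nm nN bq.
have /andP[n0 _] := nN.
have := diagonal_expansion nN bq.
rewrite sum_partition_setT// finset.big_set1 map_tnth_setT => /eqP.
rewrite -subr_eq => /eqP; set S := \sum_(P | _) _.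
have -> : S = (\sum_(P | finset.partition P [set: 'I_n]%SET &&
                        (P != [set [set: 'I_n]%SET]%SET))
    \prod_(B in P) u [seq tnth q i | i <- enum B])%:C.
  rewrite rmorph_sum; apply: eq_bigr => P /andP[pP PT].
  rewrite rmorph_prod; apply: eq_bigr => B BP; rewrite -val_subconfig.
  have /andP[B0 Bn] := block_lt pP PT BP.
  apply: IH; first exact: leq_trans Bn nm.
    by rewrite B0 (leq_trans (ltnW Bn))//; case/andP: nN.
  by apply/mem_box; rewrite val_subconfig all_block.
rewrite -rmorphB => qE; rewrite /u /box_diagonal (mem_box q).1//.
by rewrite -qE.
Qed.

(** The relation extends from the box to the whole space: if particle [i] is outside the container,
    then in each partition the factor of the block containing [i] vanishes. *)
Lemma box_diagonal_expansion n : (0 < n <= N)%N ->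
  (fun q : config R n =>
    lambda ^+ (3 * n) * (k (n:=n) \_ (box (container G) n)) q) =
  (fun q : config R n => \sum_(P | finset.partition P [set: 'I_n]%SET)
    \prod_(B in P) u [seq tnth q i | i <- enum B]).
Proof.
move=> nN; apply/funext => q; rewrite patchE.
have /andP[n0 _] := nN.
case: ifPn; rewrite ?inE ?notin_setE => bq; last first.
  rewrite mulr0 big1// => P pP.
  have [i qi] : exists i, ~ container G (tnth q i).
    by apply/existsNP.
  have iP : i \in finset.cover P.
    by rewrite (finset.cover_partition pP) finset.inE.
  rewrite (bigD1 (finset.pblock P i)) ?finset.pblock_mem//=.
  rewrite {1}/u /box_diagonal ifF ?mul0r//; apply/negP => /allP/(_ (tnth q i)).
  rewrite inE => h; apply/qi/h/map_f.
  by rewrite mem_enum finset.mem_pblock.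
apply: (fmorph_inj (real_complex R)); rewrite /=.
rewrite diagonal_expansion// rmorph_sum; apply: eq_bigr => P pP.
rewrite rmorph_prod; apply: eq_bigr => B BP; rewrite -val_subconfig.
apply: diagonal_real; last by apply/mem_box; rewrite val_subconfig all_block.
rewrite card_gt0 (partition_neq0 pP BP)/= (leq_trans (max_card _))// card_ord.
by case/andP: nN.
Qed.

Let mu := space_measure R.

Lemma kernel_patch_integrable n : (0 < n <= N)%N ->
  (config_measure R n).-integrable setT
    (fun q => ((k (n:=n) \_ (box (container G) n)) q)%:E).
Proof.
move=> nN; have := (integrable_mkcond _ (@measurable_box n)).1 (Ik nN).
by rewrite restrict_EFin.
Qed.

Lemma box_diagonal_integrable n : (0 < n <= N)%N -> power_integrable mu n u.
Proof.
have [m] := ubnP n; elim: m => // m IH in n *; rewrite ltnS => nm nN.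
have /andP[n0 nN'] := nN.
rewrite /power_integrable.
(* The one-block term is isolated; all blocks in the remaining sum have fewer than [n] elements. *)
have -> : (fun q : n.-tuple (position R) => (u q)%:E) =
    (fun q : n.-tuple (position R) =>
    (lambda ^+ (3 * n) * (k (n:=n) \_ (box (container G) n)) q)%:E -
    \sum_(P | finset.partition P [set: 'I_n]%SET &&
              (P != [set [set: 'I_n]%SET]%SET))
    (\prod_(B in P) u [seq tnth q i | i <- enum B])%:E)%E.
  apply/funext => q.
  rewrite (congr1 (@^~ q) (box_diagonal_expansion nN)) /= sum_partition_setT//.
  by rewrite sumEFin -EFinB finset.big_set1 map_tnth_setT addrK.
apply: integrableB => //.
  under eq_fun do rewrite EFinM.
  by apply: integrableZl => //; exact: kernel_patch_integrable.
apply: integrable_sum => // P /andP[pP PT].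
apply: (partition_integrable pP _).1 => B BP.
have /andP[B0 Bn] := block_lt pP PT BP.
by apply: IH; [exact: leq_trans Bn nm|rewrite B0 (leq_trans (ltnW Bn))].
Qed.

Lemma box_integral_expansion n : (0 < n <= N)%N ->
  lambda ^+ (3 * n) * \int[config_measure R n]_(q in box (container G) n) k q =
  partition_sum (fun l => power_Rintegral mu l u) [set: 'I_n]%SET.
Proof.
move=> nN; have /andP[_ nN'] := nN.
(* The box integral becomes an integral over the whole space, where products over blocks
   factorize. *)
rewrite Rintegral_mkcond -RintegralZl//; last exact: kernel_patch_integrable.
rewrite box_diagonal_expansion//.
have Iu P B : finset.partition P [set: 'I_n]%SET -> B \in P ->
    power_integrable mu #|B| u.
  move=> pP BP; apply: box_diagonal_integrable.
  rewrite card_gt0 (partition_neq0 pP BP)/= (leq_trans (max_card _))//.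
  by rewrite card_ord.
rewrite Rintegral_sum => [|P pP].
  apply: eq_bigr => P pP.
  by apply: (partition_integrable pP _).2 => B; exact: Iu.
by apply: (partition_integrable pP _).1 => B; exact: Iu.
Qed.

Lemma Cintegral_diagonal n : (0 < n <= N)%N ->
  Cintegral (box (container G) n) (fun q => U q q) =
  (power_Rintegral mu n u)%:C.
Proof.
move=> nN; rewrite /Cintegral; congr Complex.
  rewrite Rintegral_mkcond; apply: eq_Rintegral => q _.
  rewrite patchE /u /box_diagonal -diagonal_tuple.
  case: ifPn => [/[!inE] /mem_box->//|]; rewrite notin_setE => bq.
  by rewrite ifF//; apply/negP => /mem_box.
rewrite (@eq_Rintegral _ _ _ _ _ (cst 0)).
  by rewrite /Rintegral integral0.
by move=> q /[!inE] bq; rewrite -diagonal_tuple (diagonal_real nN bq).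
Qed.

End expansion.

End cluster.

(** * From partition sums to the canonical partition function *)

Lemma bellE (F : numFieldType) (x : nat -> F) (n : nat) :
  bell n x = partition_sum x [set: 'I_n]%SET.
(* For [L = M = n] the unfolded [bell_sum] is the sum in [bell]. *)
Proof. by rewrite (@partition_sumE _ _ _ _ n n) cardsT card_ord. Qed.

(** The block sizes of a partition add up to [#|D|], so the powers of [a] multiply to the same
    factor in every term. *)
Lemma partition_sum_scale (F : numFieldType) (T : finType) (a : F)
    (x y : nat -> F) (D : {set T}) :
  (forall l, (0 < l <= #|D|)%N -> y l = x l * a ^+ l) ->
  partition_sum y D = partition_sum x D * a ^+ #|D|.
Proof.
move=> yx; rewrite /partition_sum mulr_suml; apply: eq_bigr => P pP.
rewrite (card_partition pP) -prodrXr -big_split; apply: eq_bigr => B BP /=.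
rewrite yx// card_gt0 (partition_neq0 pP BP) subset_leq_card//.
exact: finset.partitionS pP BP.
Qed.

Lemma rmorph_partition_sum (F F' : numFieldType) (f : {rmorphism F -> F'})
    (T : finType) (x : nat -> F) (D : {set T}) :
  f (partition_sum x D) = partition_sum (f \o x) D.
Proof.
by rewrite rmorph_sum; apply: eq_bigr => P _; rewrite rmorph_prod.
Qed.

Theorem theorem5 (R : realType) (G : quantum_gas R) (beta : R) (N : nat)
    (psi : forall n : nat, nat -> config R n -> R[i]) (E : nat -> nat -> R)
    (U : forall n : nat, config R n -> config R n -> R[i]) :
  0 < beta ->
  (0 < N)%N ->
  (forall n, (0 < n <= N)%N -> energy_eigenbasis G (psi n) (E n)) ->
  (forall n, (0 < n <= N)%N ->
     cvgn (series (fun s => expR (- beta * E n s)))) ->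
  cluster_functions (thermal_wavelength G beta)
    (fun n => boltzmann_kernel G beta (psi n) (E n)) U ->
  (partition_function beta (E N))%:C =
  (N`!%:R)^-1 *
  bell N (fun l => (l`!%:R * volume G / thermal_wavelength G beta ^+ 3)%:C *
                   cluster_coefficient G beta U l).
Proof.
move=> beta0 N0 eigen cE HU.
set lambda := thermal_wavelength G beta in HU *.
have lambda0 : 0 < lambda.
  rewrite mulr_gt0 ?planck_gt0// sqrtr_gt0 divr_gt0// mulr_gt0 ?mass_gt0//.
  by rewrite mulr_gt0 ?pi_gt0.
have V0 : 0 < volume G.
  by rewrite fine_gt0// container_volume_gt0 container_volume_lty.
pose k n (q : config R n) := limn (series (fun s =>
  n`!%:R * expR (- beta * E n s) *
  (complex.Re (psi n s q) ^+ 2 + complex.Im (psi n s q) ^+ 2))).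
have HK n (q : config R n) : (0 < n <= N)%N -> box (container G) n q ->
    boltzmann_kernel G beta (psi n) (E n) q q = (k n q)%:C.
  move=> /eigen eig bq; apply: boltzmann_kernel_diag => // s.
  exact: eigenbasis_symmetric eig s.
have kZ n : (0 < n <= N)%N ->
    (config_measure R n).-integrable (box (container G) n)
      (fun q => (k n q)%:E) /\
    \int[config_measure R n]_(q in box (container G) n) k n q =
      n`!%:R * partition_function beta (E n).
  move=> nN; have eig := eigen _ nN; apply: boltzmann_kernel_integral.
  - exact: eigenbasis_L2 eig.
  - by move=> s; rewrite (eigenbasis_orthonormal eig) eqxx.
  - exact: cE.
  - exact: measurable_box.
have Ik n nN := (kZ n nN).1.
pose I l := power_Rintegral (space_measure R) l (box_diagonal G U).
rewrite bellE.
(* The prefactors combine to Gamma_l = lambda^{-3l} I_l, so lambda^{-3} is the scaling factor. *)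
rewrite (@partition_sum_scale _ _ ((lambda ^- 3)%:C) (real_complex R \o I)).
  rewrite -rmorph_partition_sum cardsT card_ord.
  (* The partition sum of the [I l] is lambda^{3N} N! Z; the powers of lambda cancel against the
     scaling, and N! against its inverse. *)
  rewrite -(box_integral_expansion HU HK Ik) ?N0 ?leqnn//.
  rewrite (kZ N _).2 ?N0 ?leqnn//.
  rewrite -(rmorph_nat (real_complex R)) -fmorphV -rmorphXn -!rmorphM.
  congr (_%:C).
  have N1 : N`!%:R != 0 :> R by rewrite pnatr_eq0 -lt0n fact_gt0.
  have l1 : lambda ^+ (3 * N) != 0 by rewrite expf_neq0// gt_eqF.
  rewrite exprVn -exprM; move: (N`!%:R) (lambda ^+ (3 * N)) N1 l1 => a b a0 b0.
  by field; rewrite a0 b0.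
rewrite cardsT card_ord => l lN.
rewrite /cluster_coefficient (Cintegral_diagonal HU HK lN) -/lambda.
rewrite -rmorphXn -!rmorphM; congr (_%:C).
rewrite exprVn -exprM -/(I l).
have l1 : l`!%:R != 0 :> R by rewrite pnatr_eq0 -lt0n fact_gt0.
(* As [l] is positive, the powers of lambda in Gamma_l and b_l together make lambda^{3l}, while l!
   and V cancel. *)
have -> : (3 * l = 3 + 3 * l.-1)%N by lia.
rewrite exprD.
have b1 : lambda ^+ (3 * l.-1) != 0 by rewrite expf_neq0// gt_eqF.
move: (l`!%:R) (lambda ^+ (3 * l.-1)) (I l) l1 b1 => a b c a0 b0.
by field; rewrite a0 b0 !gt_eqF.
Qed.
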